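(* Let $R$ be a commutative ring. Then $$H^n(\mathrm{S}_{11}(R),\mathrm{M}_3(R)/\mathrm{S}_{11}(R))\cong\begin{cases}R & (n=0,1),\\ 0 & (n\ge2).\end{cases}$$
   Context: $\mathrm{S}_{11}(R)=\left\{\begin{pmatrix}a&b&c\\0&e&d\\0&0&a\end{pmatrix}\mid a,b,c,d,e\in R\right\}\subseteq\mathrm{M}_3(R)$. $H^n$ is Hochschild cohomology, with $\mathrm{M}_3(R)/\mathrm{S}_{11}(R)$ a bimodule via matrix multiplication. *)

(* Defs.v *)
(* Hochschild cohomology H^n(A, M) of the R-algebra
   A = S_11(R) with coefficients in the A-bimodule M = M_3(R)/S_11(R),
   via the standard (R-relative) Hochschild cochain complex:
   C^n(A,M) = R-multilinear maps A^n -> M.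
   Elements of A are represented by 3x3 matrices satisfying [S11];
   elements of M by 3x3 matrices, two being equal in M iff their
   difference lies in S11. *)
From HB Require Import structures.
From mathcomp Require Import all_boot all_order all_algebra.
Set Implicit Arguments. Unset Strict Implicit. Unset Printing Implicit Defensive.
Import GRing.Theory.
Local Open Scope ring_scope.

Section Hochschild.
Variable R : comPzRingType.

Definition mx3 := 'M[R]_3.

Definition S11_entry (a b c d e : R) (i j : nat) : R :=
  match i, j with
  | 0, 0 => a | 0, 1 => b | 0, 2 => c
  | 1, 1 => e | 1, 2 => d
  | 2, 2 => a
  | _, _ => 0
  end.

Definition mx_S11 (a b c d e : R) : mx3 :=
  \matrix_(i < 3, j < 3) S11_entry a b c d e i j.

Definition S11 (x : mx3) : Prop :=
  exists a b c d e : R, x = mx_S11 a b c d e.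

Definition cochain_fun (n : nat) := ('I_n -> mx3) -> mx3.

Definition tupS (n : nat) (a : 'I_n -> mx3) : Prop := forall i, S11 (a i).

Definition cequiv (n : nat) (f g : cochain_fun n) : Prop :=
  forall a, tupS a -> S11 (f a - g a).

Definition tset (n : nat) (a : 'I_n -> mx3) (i : 'I_n) (v : mx3) : 'I_n -> mx3 :=
  fun j => if j == i then v else a j.

Definition cochain (n : nat) (f : cochain_fun n) : Prop :=
  forall (a : 'I_n -> mx3) (i : 'I_n) (x y : mx3) (r : R),
    tupS a -> S11 x -> S11 y ->
    S11 (f (tset a i (r *: x + y)) - (r *: f (tset a i x) + f (tset a i y))).

Definition ext (n : nat) (a : 'I_n.+1 -> mx3) (k : nat) : mx3 :=
  if (k < n.+1)%N then a (inord k) else 0.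

Definition ttail (n : nat) (a : 'I_n.+1 -> mx3) : 'I_n -> mx3 :=
  fun j => ext a (nat_of_ord j).+1.

Definition tinit (n : nat) (a : 'I_n.+1 -> mx3) : 'I_n -> mx3 :=
  fun j => ext a (nat_of_ord j).

Definition tmerge (n : nat) (i : nat) (a : 'I_n.+1 -> mx3) : 'I_n -> mx3 :=
  fun j => let k := nat_of_ord j in
    if (k < i)%N then ext a k
    else if k == i :> nat then ext a k *m ext a k.+1
    else ext a k.+1.

Definition hdiff (n : nat) (f : cochain_fun n) : cochain_fun n.+1 :=
  fun a => ext a 0 *m f (ttail a)
         + \sum_(i < n) ((-1) ^+ i.+1) *: f (tmerge i a)
         + ((-1) ^+ n.+1) *: (f (tinit a) *m ext a n).

Definition cocycle (n : nat) (f : cochain_fun n) : Prop :=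
  cochain f /\ forall a : 'I_n.+1 -> mx3, tupS a -> S11 (hdiff f a).

Definition coboundary (n : nat) : cochain_fun n -> Prop :=
  match n as n0 return cochain_fun n0 -> Prop with
  | 0 => fun f => cequiv f (fun _ => 0)
  | m.+1 => fun f => exists g : cochain_fun m, cochain g /\ cequiv (hdiff g) f
  end.

(* H^n(A,M) is isomorphic to R (as R-modules): there is an R-linear
   surjection from the n-cocycles onto R whose kernel is exactly the
   n-coboundaries (first isomorphism theorem). *)
Definition H_iso_R (n : nat) : Prop :=
  exists phi : cochain_fun n -> R,
    [/\ forall (f g : cochain_fun n) (r : R), cocycle f -> cocycle g ->
          phi (fun a => r *: f a + g a) = r * phi f + phi g,
        forall r : R, exists f : cochain_fun n, cocycle f /\ phi f = r
      & forall f : cochain_fun n, cocycle f -> (phi f = 0 <-> coboundary f)].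

Definition H_zero (n : nat) : Prop :=
  forall f : cochain_fun n, cocycle f -> coboundary f.

End Hochschild.

(* Main.v *)
Require Import Defs.
From mathcomp Require Import all_boot all_order all_algebra ring.
From Stdlib Require Import FunctionalExtensionality.
Set Implicit Arguments. Unset Strict Implicit. Unset Printing Implicit Defensive.
Import GRing.Theory.

(* Write A = S_11(R), M = M_3(R)/A, e1 = E11 + E33, e2 = E22, alpha = E12 and
   beta = E23, so that beta alpha = 0.  The classes of the matrices E33, E32, E21,
   E31 generate a filtration of M by sub-bimodules, and in degrees n >= 2 the
   cohomology of each layer vanishes, so a cocycle can be killed layer by layer.
   - If A acts on the left through the entry a (layers E31 and <E32, E33>), a
     cocycle f is the coboundary of
       g(x, s) = f(e1, x, s) - f(alpha, alpha^{-1} x, s),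
     where alpha^{-1} inverts left multiplication by alpha on alpha A = alpha e2 A
     and is 0 on e1 and e2 A.
   - If A acts on the left through the entry e (layer E21), subtracting the
     coboundary of f(e2, -) from f leaves d_x f(beta, s), where d_x is the E23
     entry of x.  As beta x = a_x beta, f(beta, -) is a cocycle of degree n - 1
     for the left action through a, hence the coboundary of some g', and then
     f is the coboundary of f(e2, x, s) - d_x g'(s).
   In degree 0 the invariants are the multiples of E33.  In degree 1 a
   derivation D is inner iff D(alpha)_32 + D(beta)_21 = 0. *)

Local Open Scope ring_scope.

(** * Bar complex of an associative algebra *)

Record assoc_alg (R : pzRingType) := AssocAlg {
  alg_sort :> lmodType R;
  amul : alg_sort -> alg_sort -> alg_sort;
  amulA : associative amul;
  amulPl : forall r x y z, amul (r *: x + y) z = r *: amul x z + amul y z;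
  amulPr : forall r x y z, amul x (r *: y + z) = r *: amul x y + amul x z }.

Record bimodule (R : pzRingType) (A : assoc_alg R) := Bimodule {
  bimod_sort :> lmodType R;
  lact : A -> bimod_sort -> bimod_sort;
  ract : bimod_sort -> A -> bimod_sort;
  lactM : forall a b m, lact (amul a b) m = lact a (lact b m);
  ractM : forall m a b, ract m (amul a b) = ract (ract m a) b;
  lractA : forall a m b, ract (lact a m) b = lact a (ract m b);
  lactPl : forall r a b m, lact (r *: a + b) m = r *: lact a m + lact b m;
  lactPr : forall r a m n, lact a (r *: m + n) = r *: lact a m + lact a n;
  ractPl : forall r m n a, ract (r *: m + n) a = r *: ract m a + ract n a;
  ractPr : forall r m a b, ract m (r *: a + b) = r *: ract m a + ract m b }.

Lemma morph_subr (R : pzRingType) (V V' : lmodType R) (phi : V -> V') :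
  (forall r x y, phi (r *: x + y) = r *: phi x + phi y) ->
  {morph phi : x y / x - y}.
Proof.
by move=> lin x y; rewrite addrC -[- y]scaleN1r lin scaleN1r addrC.
Qed.

Section Bar.
Variables (R : pzRingType) (A : assoc_alg R).
Local Notation "x ** y" := (amul x y) (at level 40, left associativity).

(* [cract f] is the right action of [A] on cochains,
   (f.a)(x1,...,xk) = f(a x1, x2, ...) - f(a, x1 x2, ...) + ... +- f(a, x1, ...) xk,
   for which D(a) = f(a, -) is a derivation exactly when [f] is a cocycle. *)
Fixpoint cract (W : bimodule A) (f : seq A -> W) (a : A) (s : seq A) : W :=
  match s with
  | [::] => ract (f [::]) a
  | x :: s' => f (a ** x :: s') - cract (fun t => f (a :: t)) x s'
  end.

(** A cochain is one function on lists of every length, so a single function carries all degrees.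
    The value at the empty list is a default. *)
Definition cdiff (W : bimodule A) (f : seq A -> W) (s : seq A) : W :=
  if s is a :: s' then lact a (f s') - cract f a s' else 0.

Definition multilinear (V : lmodType R) (f : seq A -> V) : Prop :=
  forall s r x y t,
    f (s ++ (r *: x + y) :: t) = r *: f (s ++ x :: t) + f (s ++ y :: t).

(* [f] is a cocycle in degree [k.+1]: [s] lists all but two of its [k.+2] arguments. *)
Definition cocycle_at (W : bimodule A) (k : nat) (f : seq A -> W) : Prop :=
  forall a b s, size s = k -> cdiff f (a :: b :: s) = 0.

(** * Formal properties of the differential: linearity, functoriality, square zero *)

Section Theory.
Variable W : bimodule A.
Implicit Types (f g : seq A -> W) (a b x y : A) (s t : seq A).

Lemma lactB a (m n : W) : lact a (m - n) = lact a m - lact a n.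
Proof. by apply: (morph_subr (phi := lact a)) => r x y; apply: lactPr. Qed.

Lemma ractB (m n : W) a : ract (m - n) a = ract m a - ract n a.
Proof. by apply: (morph_subr (phi := fun m : W => ract m a)) => r x y; apply: ractPl. Qed.

Lemma ract0l a : ract (0 : W) a = 0.
Proof. by rewrite -[in LHS](subrr (0 : W)) ractB subrr. Qed.

Lemma cract_cons f a x s :
  cract f a (x :: s) = f (a ** x :: s) - cract (fun t => f (a :: t)) x s.
Proof. by []. Qed.

Lemma cdiff_cons f a s : cdiff f (a :: s) = lact a (f s) - cract f a s.
Proof. by []. Qed.

Lemma eq_cract f g a s :
  (forall t, size t = size s -> f t = g t) -> cract f a s = cract g a s.
Proof.
elim: s f g a => [|x s IH] f g a eqfg /=; first by rewrite eqfg.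
by rewrite eqfg //; congr (_ - _); apply: IH => t st; rewrite eqfg //= st.
Qed.

Lemma eq_cdiff f g s :
  (forall t, size t = (size s).-1 -> f t = g t) -> cdiff f s = cdiff g s.
Proof. by case: s => //= a s eqfg; rewrite eqfg // (eq_cract _ eqfg). Qed.

Lemma cract_linear r f g a s :
  cract (fun t => r *: f t + g t) a s = r *: cract f a s + cract g a s.
Proof.
elim: s f g a => [|x s IH] f g a /=; first by rewrite ractPl.
by rewrite IH scalerBr opprD addrACA.
Qed.

Lemma cractB f g a s :
  cract (fun t => f t - g t) a s = cract f a s - cract g a s.
Proof.
by elim: s f g a => [|x s IH] f g a /=; rewrite ?ractB // IH opprD addrACA -opprD.
Qed.

Lemma cdiff_linear r f g s :
  cdiff (fun t => r *: f t + g t) s = r *: cdiff f s + cdiff g s.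
Proof.
case: s => [|a s] /=; first by rewrite scaler0 addr0.
by rewrite lactPr cract_linear scalerBr opprD addrACA.
Qed.

Lemma cdiffB f g s : cdiff (fun t => f t - g t) s = cdiff f s - cdiff g s.
Proof.
case: s => [|a s] /=; first by rewrite subr0.
by rewrite lactB cractB opprD addrACA -opprD.
Qed.

Lemma cdiffD f g s : cdiff (fun t => f t + g t) s = cdiff f s + cdiff g s.
Proof.
rewrite -[cdiff f s]scale1r -cdiff_linear.
by apply: eq_cdiff => t _; rewrite scale1r.
Qed.

Lemma cdiff0 s : cdiff (fun _ => 0 : W) s = 0.
Proof.
rewrite -[RHS](subrr (cdiff (fun _ => 0 : W) s)) -cdiffB.
by apply: eq_cdiff => t _; rewrite subr0.
Qed.

(** The right-module axiom for the action on cochains, which is what makes the differential square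
    to zero. *)
Lemma cract_actM f a b s : cract (cract f a) b s = cract f (a ** b) s.
Proof.
elim: s f a b => [|x s IH] f a b /=; first by rewrite ractM.
by rewrite cractB IH amulA opprB addrA subrK.
Qed.

(** Only the right action has to be respected, so [phi] may be [lact a], or a map such as [quo_q]
    that is not left linear. *)
Lemma cract_morph (W' : bimodule A) (phi : W -> W') f a s :
  {morph phi : m n / m - n} ->
  (forall m b, phi (ract m b) = ract (phi m) b) ->
  phi (cract f a s) = cract (fun t => phi (f t)) a s.
Proof.
move=> phiB phiR; elim: s f a => [|x s IH] f a /=; first exact: phiR.
by rewrite phiB IH.
Qed.

Lemma cdiff_morph (W' : bimodule A) (phi : W -> W') f s :
  {morph phi : m n / m - n} ->
  (forall b m, phi (lact b m) = lact b (phi m)) ->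
  (forall m b, phi (ract m b) = ract (phi m) b) ->
  phi (cdiff f s) = cdiff (fun t => phi (f t)) s.
Proof.
move=> phiB phiL phiR; case: s => [|a s] /=.
  by rewrite -(subrr 0) phiB subrr.
by rewrite phiB phiL (cract_morph _ _ _ phiB phiR).
Qed.

Lemma cdiffK f a b s : cdiff (cdiff f) (a :: b :: s) = 0.
Proof.
rewrite /= -/(cdiff _ _) cractB cract_actM.
rewrite -(cract_morph (phi := lact a)); [|exact: lactB|by move=> *; rewrite lractA].
by rewrite lactB lactM opprB !addrA subrK subrr.
Qed.

(** The Leibniz rule for D(a) = f(a, -). *)
Lemma cocycle_atE k f a b s : cocycle_at k f -> size s = k ->
  f (a ** b :: s) = lact a (f (b :: s)) + cract (fun t => f (a :: t)) b s.
Proof.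
move=> cf /(cf a b) /= /eqP; rewrite opprB addrA subr_eq0 => /eqP <- //.
Qed.

Lemma cocycle_atB_cdiff k f g :
  cocycle_at k f -> cocycle_at k (fun t => f t - cdiff g t).
Proof. by move=> cf a b s sk; rewrite cdiffB cdiffK cf // subr0. Qed.

Lemma multilinear_cons f r x y t : multilinear f ->
  f ((r *: x + y) :: t) = r *: f (x :: t) + f (y :: t).
Proof. by move=> /(_ [::]); apply. Qed.

Lemma multilinear_cons0 f t : multilinear f -> f (0 :: t) = 0.
Proof.
move=> mf; have := multilinear_cons (-1) 0 0 t mf.
by rewrite scaler0 addr0 scaleN1r addNr.
Qed.

Lemma multilinear_consZ f r x t : multilinear f ->
  f (r *: x :: t) = r *: f (x :: t).
Proof.
move=> mf; have := multilinear_cons r x 0 t mf.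
by rewrite multilinear_cons0 // !addr0.
Qed.

Lemma multilinear_behead f a : multilinear f -> multilinear (fun t => f (a :: t)).
Proof. by move=> mf s; apply: (mf (a :: s)). Qed.

Lemma cract_linear_arg f r x y s : multilinear f ->
  cract f (r *: x + y) s = r *: cract f x s + cract f y s.
Proof.
case: s => [|z s] mf /=; first by rewrite ractPr.
rewrite amulPl multilinear_cons // scalerBr addrACA -opprD -cract_linear.
by congr (_ - _); apply: eq_cract => t _; rewrite multilinear_cons.
Qed.

Lemma multilinear_cract f a : multilinear f -> multilinear (cract f a).
Proof.
move=> mf s r x y t; elim: s f a mf => [|z s IH] f a mf /=.
  rewrite amulPr multilinear_cons // cract_linear_arg; last exact: multilinear_behead.
  by rewrite scalerBr opprD addrACA.
rewrite IH; last exact: multilinear_behead.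
by rewrite (mf (_ :: s)) scalerBr opprD addrACA.
Qed.

Lemma multilinear_cdiff f : multilinear f -> multilinear (cdiff f).
Proof.
move=> mf [|a s] r x y t /=.
  by rewrite lactPl cract_linear_arg // scalerBr opprD addrACA.
by rewrite mf lactPr multilinear_cract // scalerBr opprD addrACA.
Qed.

Lemma multilinearB (V : lmodType R) (f g : seq A -> V) :
  multilinear f -> multilinear g -> multilinear (fun t => f t - g t).
Proof.
by move=> mf mg s r x y t; rewrite mf mg scalerBr opprD addrACA.
Qed.

Lemma multilinearD (V : lmodType R) (f g : seq A -> V) :
  multilinear f -> multilinear g -> multilinear (fun t => f t + g t).
Proof.
by move=> mf mg s r x y t; rewrite mf mg scalerDr addrACA.
Qed.

End Theory.
End Bar.

(** * The algebra [S_11] and its bimodules *)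

Section S11Algebra.
Variable R : comPzRingType.

(* [(a, b, c, d, e)] stands for [mx_S11 a b c d e]. *)
Definition s11_vec := (R^o * R^o * R^o * R^o * R^o)%type.
Implicit Types x y z : s11_vec.

Definition s11_mul x y : s11_vec :=
  let: (a, b, c, d, e) := x in let: (a', b', c', d', e') := y in
  (a * a', a * b' + b * e', a * c' + b * d' + c * a', e * d' + d * a', e * e').

Lemma scale_regularE (r : R) (x : R^o) : r *: x = r * x :> R.
Proof. by []. Qed.

Lemma s11_mulA : associative s11_mul.
Proof.
move=> [[[[a b] c] d] e] [[[[a1 b1] c1] d1] e1] [[[[a2 b2] c2] d2] e2].
by congr (_, _, _, _, _) => /=; ring.
Qed.

Lemma s11_mulPl r x y z :
  s11_mul (r *: x + y) z = r *: s11_mul x z + s11_mul y z.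
Proof.
move: x y z => [[[[a b] c] d] e] [[[[a1 b1] c1] d1] e1] [[[[a2 b2] c2] d2] e2].
by congr (_, _, _, _, _); rewrite /= ?scale_regularE; ring.
Qed.

Lemma s11_mulPr r x y z :
  s11_mul x (r *: y + z) = r *: s11_mul x y + s11_mul x z.
Proof.
move: x y z => [[[[a b] c] d] e] [[[[a1 b1] c1] d1] e1] [[[[a2 b2] c2] d2] e2].
by congr (_, _, _, _, _); rewrite /= ?scale_regularE; ring.
Qed.

Definition s11 : assoc_alg R := AssocAlg s11_mulA s11_mulPl s11_mulPr.

Definition ca (x : s11) : R := x.1.1.1.1.
Definition cb (x : s11) : R := x.1.1.1.2.
Definition cc (x : s11) : R := x.1.1.2.
Definition cd (x : s11) : R := x.1.2.
Definition ce (x : s11) : R := x.2.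

Lemma caM (x y : s11) : ca (amul x y) = ca x * ca y.
Proof. by move: x y => [[[[a b] c] d] e] [[[[a1 b1] c1] d1] e1]. Qed.

Lemma cbM (x y : s11) : cb (amul x y) = ca x * cb y + cb x * ce y.
Proof. by move: x y => [[[[a b] c] d] e] [[[[a1 b1] c1] d1] e1]. Qed.

Lemma ccM (x y : s11) : cc (amul x y) = ca x * cc y + cb x * cd y + cc x * ca y.
Proof. by move: x y => [[[[a b] c] d] e] [[[[a1 b1] c1] d1] e1]. Qed.

Lemma cdM (x y : s11) : cd (amul x y) = ce x * cd y + cd x * ca y.
Proof. by move: x y => [[[[a b] c] d] e] [[[[a1 b1] c1] d1] e1]. Qed.

Lemma ceM (x y : s11) : ce (amul x y) = ce x * ce y.
Proof. by move: x y => [[[[a b] c] d] e] [[[[a1 b1] c1] d1] e1]. Qed.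

Definition s11M := (caM, cbM, ccM, cdM, ceM).

Lemma caP r (x y : s11) : ca (r *: x + y) = r * ca x + ca y.
Proof. by move: x y => [[[[a b] c] d] e] [[[[a1 b1] c1] d1] e1]. Qed.
Lemma cbP r (x y : s11) : cb (r *: x + y) = r * cb x + cb y.
Proof. by move: x y => [[[[a b] c] d] e] [[[[a1 b1] c1] d1] e1]. Qed.
Lemma ccP r (x y : s11) : cc (r *: x + y) = r * cc x + cc y.
Proof. by move: x y => [[[[a b] c] d] e] [[[[a1 b1] c1] d1] e1]. Qed.
Lemma cdP r (x y : s11) : cd (r *: x + y) = r * cd x + cd y.
Proof. by move: x y => [[[[a b] c] d] e] [[[[a1 b1] c1] d1] e1]. Qed.
Lemma ceP r (x y : s11) : ce (r *: x + y) = r * ce x + ce y.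
Proof. by move: x y => [[[[a b] c] d] e] [[[[a1 b1] c1] d1] e1]. Qed.

Definition s11E := (s11M, (caP, cbP, ccP, cdP, ceP)).

(** The layer of E31. The two indices tell which of e1, e2 acts as the identity on the left and on
    the right; E31 gets 11 because e1 = E11 + E33. *)
Definition simple11 : bimodule s11.
Proof.
exists (R^o : lmodType R) (fun x m => ca x * m) (fun m x => m * ca x).
all: move=> *; rewrite ?s11E;
  do ?apply: injective_projections; rewrite /= ?scale_regularE; ring.
Defined.

Definition simple21 : bimodule s11.
Proof.
exists (R^o : lmodType R) (fun x m => ce x * m) (fun m x => m * ca x).
all: move=> *; rewrite ?s11E;
  do ?apply: injective_projections; rewrite /= ?scale_regularE; ring.
Defined.

(* The sub-bimodule of [quo] generated by the classes of E32 and E33. *)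
Definition sub_rs : bimodule s11.
Proof.
exists (R^o * R^o)%type (fun x m => (ca x * m.1, ca x * m.2))
  (fun m x => (m.1 * ce x, m.1 * cd x + m.2 * ca x)).
all: move=> *; rewrite ?s11E;
  do ?apply: injective_projections; rewrite /= ?scale_regularE; ring.
Defined.

(* M_3(R)/S_11(R), in the coordinates (m31, m21, m32, m33 - m11) of the class of m. *)
Definition quo : bimodule s11.
Proof.
exists (R^o * R^o * R^o * R^o)%type
  (fun x m => (ca x * m.1.1.1, ce x * m.1.1.2 + cd x * m.1.1.1, ca x * m.1.2,
               ca x * m.2 - cb x * m.1.1.2 - cc x * m.1.1.1))
  (fun m x => (m.1.1.1 * ca x, m.1.1.2 * ca x, m.1.1.1 * cb x + m.1.2 * ce x,
               m.1.1.1 * cc x + m.1.2 * cd x + m.2 * ca x)).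
all: move=> *; rewrite ?s11E;
  do ?apply: injective_projections; rewrite /= ?scale_regularE; ring.
Defined.

End S11Algebra.

(** * Vanishing in degrees at least two *)

Section Vanishing.
Variable R : comPzRingType.
Local Notation A := (s11 R).
Local Notation "x ** y" := (amul x y) (at level 40, left associativity).
Implicit Types x y : A.

Definition e1 : A := (1, 0, 0, 0, 0).
Definition e2 : A := (0, 0, 0, 0, 1).
Definition alpha : A := (0, 1, 0, 0, 0).
Definition beta : A := (0, 0, 0, 1, 0).

(* [alpha_div (alpha x) = e2 x]. *)
Definition alpha_div x : A := (0, 0, 0, cc x, cb x).

Lemma e1E : (ca e1 = 1) * (cb e1 = 0) * (cc e1 = 0).
Proof. by rewrite /ca /cb /cc. Qed.

Lemma alphaE : (ca alpha = 0) * (cb alpha = 1) * (cc alpha = 0).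
Proof. by rewrite /ca /cb /cc. Qed.

Lemma alpha_divE x :
  (ca (alpha_div x) = 0) * (cb (alpha_div x) = 0) * (cc (alpha_div x) = 0)
  * (cd (alpha_div x) = cc x) * (ce (alpha_div x) = cb x).
Proof. by rewrite /ca /cb /cc /cd /ce. Qed.

Lemma alpha_div_linear r x y : alpha_div (r *: x + y) = r *: alpha_div x + alpha_div y.
Proof.
rewrite /alpha_div !s11E.
by do !apply: injective_projections; rewrite /= ?scale_regularE; ring.
Qed.

(** So [alpha_div] is a derivation when A acts on the left through [ca]. *)
Lemma alpha_divM x y : alpha_div (x ** y) = ca x *: alpha_div y + alpha_div x ** y.
Proof.
move: x y => [[[[a b] c] d] e] [[[[a' b'] c'] d'] e'].
by do !apply: injective_projections;
  rewrite /= /cb /cc /ca ?scale_regularE /=; ring.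
Qed.

(** The decomposition of e1 A as R e1 plus alpha A, the second summand being parametrised by
    [alpha_div]. *)
Lemma e1_mul x : e1 ** x = ca x *: e1 + alpha ** alpha_div x.
Proof.
move: x => [[[[a b] c] d] e].
by do !apply: injective_projections;
  rewrite /= /cb /cc /ca ?scale_regularE /=; ring.
Qed.

Lemma e2_mul x : e2 ** x = ce x *: e2 + cd x *: beta.
Proof.
move: x => [[[[a b] c] d] e].
by do !apply: injective_projections;
  rewrite /= /cd /ce ?scale_regularE /=; ring.
Qed.

Lemma beta_mul x : beta ** x = ca x *: beta.
Proof.
move: x => [[[[a b] c] d] e].
by do !apply: injective_projections;
  rewrite /= /ca ?scale_regularE /=; ring.
Qed.

Lemma vanishing_left1 (W : bimodule A) (k : nat) (f : seq A -> W) :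
  (forall x (m : W), lact x m = ca x *: m) ->
  (k = 0 -> forall (m : W) x, ract m (alpha_div x) = 0) ->
  multilinear f -> cocycle_at k f ->
  exists2 g : seq A -> W, multilinear g &
    forall x s, size s = k -> f (x :: s) = cdiff g (x :: s).
Proof.
move=> lactE ract0 mf cf.
pose g0 s := f (e1 :: s).
pose g1 s := if s is x :: t then f (alpha :: alpha_div x :: t) else 0.
exists (fun s => g0 s - g1 s).
  apply: multilinearB; first exact: multilinear_behead.
  case=> [|z s] r x y t; last exact: (mf [:: alpha, alpha_div z & s]).
  by rewrite /g1 /= alpha_div_linear; apply: (mf [:: alpha]).
move=> x s sk; rewrite cdiffB.
(* Leibniz on both sides of e1 x = a_x e1 + alpha alpha_div(x); on the left, e1 acts as 1 and alpha
   as 0. *)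
have -> : cdiff g0 (x :: s) =
    f (x :: s) - cract (fun t => f (alpha :: t)) (alpha_div x) s.
  have := cocycle_atE e1 x cf sk; rewrite e1_mul multilinear_cons //.
  rewrite (cocycle_atE _ _ cf sk) !lactE /= -/g0 lactE.
  rewrite /ca /= scale0r add0r scale1r -/(ca x) => E.
  by apply/eqP; rewrite eq_sym subr_eq addrAC E addrK.
suff -> : cdiff g1 (x :: s) = - cract (fun t => f (alpha :: t)) (alpha_div x) s.
  by rewrite opprK subrK.
(* For k = 0, [g1] is only evaluated at the empty list, where it is 0; the hypothesis on [ract]
   kills the remaining term. Otherwise [alpha_divM] cancels the left action against part of the
   first product. *)
case: s sk => [/esym k0|y t sk].
  by rewrite /= ract0 // lactE scaler0 ract0l subr0 oppr0.
rewrite cdiff_cons !cract_cons /g1 lactE alpha_divM.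
rewrite (multilinear_cons _ _ _ _ (multilinear_behead _ mf)).
by rewrite -addrA opprD addrA subrr add0r.
Qed.

(** Both simple modules are R with the right action through [ca]; only their left actions differ. *)
Lemma cract_simple (f : seq A -> R) r x s :
  cract (fun t => r * f t : simple21 R) x s
    = r * cract (f : seq A -> simple11 R) x s.
Proof.
apply/esym; apply: (@cract_morph _ _ (simple11 R) (simple21 R) ( *%R r)).
  by move=> m n; rewrite mulrBr.
by move=> m y; rewrite /= mulrA.
Qed.

Lemma cract_simple21 (f : seq A -> R) x s :
  cract (f : seq A -> simple21 R) x s = cract (f : seq A -> simple11 R) x s.
Proof. exact: (@cract_morph _ _ (simple21 R) (simple11 R) id). Qed.

(** The degree is k + 2: in degree one, [cd] itself is a derivation into [simple21], and it is not
    inner unless R = 0. *)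
Lemma vanishing21 (k : nat) (f : seq A -> simple21 R) :
  multilinear f -> cocycle_at k.+1 f ->
  exists2 g : seq A -> simple21 R, multilinear g &
    forall x s, size s = k.+1 -> f (x :: s) = cdiff g (x :: s).
Proof.
move=> mf cf; pose h : seq A -> simple11 R := fun s => f (beta :: s).
have [||||g' mg' hE] := @vanishing_left1 (simple11 R) k h.
- by [].
- by move=> _ m x; rewrite /= /ca /= mulr0.
- exact: multilinear_behead.
(* In the identity at (beta, x, y, s) beta acts on the left by 0, and beta x = a_x beta turns the
   first product into the left action of [simple11]. *)
- move=> x y s sk; have := cf beta x (y :: s) (congr1 S sk).
  rewrite !cdiff_cons cract_cons beta_mul.
  rewrite multilinear_consZ //= mul0r sub0r => /eqP.
  by rewrite oppr_eq0 => /eqP <-; rewrite cract_simple21.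
pose g0 s := f (e2 :: s).
pose g1 s : simple21 R := if s is x :: t then cd x * g' t else 0.
exists (fun s => g0 s - g1 s).
  apply: multilinearB; first exact: multilinear_behead.
  case=> [|z s] r x y t /=; first by rewrite /g1 /= cdP scale_regularE; ring.
  by rewrite /g1 /= mg' !scale_regularE; ring.
move=> x s sk; rewrite cdiffB.
have -> : cdiff g0 (x :: s) = f (x :: s) - cd x *: h s.
  have := cocycle_atE e2 x cf sk.
  rewrite e2_mul multilinear_cons // multilinear_consZ // -/(h s) => E.
  apply/eqP; rewrite eq_sym subr_eq addrAC E.
  by rewrite /= mul1r addrK.
(* As [cd] is a derivation, dg1(x, s) = - d_x dg'(s), which cancels the defect of dg0. *)
case: s sk => // y s [sk].
rewrite hE // !cdiff_cons cract_cons /g1 cract_simple /= cdM scale_regularE.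
ring.
Qed.

(** * The layers of M and vanishing for M *)

Definition quo_p (m : quo R) : simple11 R := m.1.1.1.
Definition quo_q (m : quo R) : simple21 R := m.1.1.2.
Definition quo_rs (m : quo R) : sub_rs R := (m.1.2, m.2).
(** A linear lift only, as is [of_q]: subtracting the coboundary of a lift clears one layer and may
    alter the layers below it. *)
Definition of_p (u : R) : quo R := (u, 0, 0, 0).
Definition of_q (u : R) : quo R := (0, u, 0, 0).
Definition of_rs (n : sub_rs R) : quo R := (0, 0, n.1, n.2).

Lemma quo_pP r m n : quo_p (r *: m + n) = r *: quo_p m + quo_p n.
Proof. by move: m n => [[[m ?] ?] ?] [[[n ?] ?] ?]. Qed.

Lemma quo_qP r m n : quo_q (r *: m + n) = r *: quo_q m + quo_q n.
Proof. by move: m n => [[[? m] ?] ?] [[[? n] ?] ?]. Qed.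

Lemma quo_pB : {morph quo_p : m n / m - n}.
Proof. by move=> [[[m ?] ?] ?] [[[n ?] ?] ?]. Qed.

Lemma quo_qB : {morph quo_q : m n / m - n}.
Proof. by move=> [[[? m] ?] ?] [[[? n] ?] ?]. Qed.

Lemma of_rsK (m : quo R) : quo_p m = 0 -> quo_q m = 0 -> of_rs (quo_rs m) = m.
Proof. by move: m => [[[? ?] ?] ?]; rewrite /quo_p /quo_q /= => -> ->. Qed.

Lemma quo_p_cdiff (f : seq A -> quo R) s :
  quo_p (cdiff f s) = cdiff (fun t => quo_p (f t)) s.
Proof. exact: cdiff_morph. Qed.

(** Only the left action feeds the E31 coordinate into the E21 one, and f(s) is the only value acted
    on from the left. *)
Lemma quo_q_cdiff (f : seq A -> quo R) x s : quo_p (f s) = 0 ->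
  quo_q (cdiff f (x :: s)) = cdiff (fun t => quo_q (f t)) (x :: s).
Proof.
move=> pf; rewrite !cdiff_cons -(@cract_morph _ _ _ _ quo_q) //.
rewrite -[LHS]/(quo_q (lact x (f s)) - _); congr (_ - _).
by rewrite /quo_q /= -/(quo_p (f s)) pf mulr0 addr0.
Qed.

Lemma of_rs_cdiff (f : seq A -> sub_rs R) s :
  of_rs (cdiff f s) = cdiff (fun t => of_rs (f t)) s.
Proof.
apply: cdiff_morph => [m n|x m|m x];
  do !apply: injective_projections; rewrite /= ?scale_regularE; ring.
Qed.

Lemma vanishing_quo (k : nat) (f : seq A -> quo R) :
  multilinear f -> cocycle_at k.+1 f ->
  exists2 g : seq A -> quo R, multilinear g &
    forall x s, size s = k.+1 -> f (x :: s) = cdiff g (x :: s).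
Proof.
move=> mf cf.
have [||||p mp pE] := @vanishing_left1 (simple11 R) k.+1 (fun s => quo_p (f s)).
- by [].
- by [].
- by move=> s r x y t; rewrite mf quo_pP.
- by move=> x y s sk; rewrite -quo_p_cdiff cf.
pose g1 s := of_p (p s).
have mg1 : multilinear g1.
  move=> s r x y t; rewrite /g1 mp.
  by do !apply: injective_projections; rewrite /= ?scale_regularE; ring.
pose f1 s := f s - cdiff g1 s.
have mf1 : multilinear f1 by apply: multilinearB => //; apply: multilinear_cdiff.
have cf1 : cocycle_at k.+1 f1 by apply: cocycle_atB_cdiff.
have pf1 x s : size s = k.+1 -> quo_p (f1 (x :: s)) = 0.
  move=> sk; have := pE x s sk; rewrite -[cdiff p _](quo_p_cdiff g1) => E.
  by rewrite /f1 quo_pB E subrr.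
have [||q mq qE] := @vanishing21 k (fun s => quo_q (f1 s)).
- by move=> s r x y t; rewrite mf1 quo_qP.
- move=> x y s sk; have /(congr1 quo_q) := cf1 x y s sk.
  by rewrite quo_q_cdiff // pf1.
pose g2 s := of_q (q s).
have mg2 : multilinear g2.
  move=> s r x y t; rewrite /g2 mq.
  by do !apply: injective_projections; rewrite /= ?scale_regularE; ring.
pose f2 s := f1 s - cdiff g2 s.
have mf2 : multilinear f2 by apply: multilinearB => //; apply: multilinear_cdiff.
have cf2 : cocycle_at k.+1 f2 by apply: cocycle_atB_cdiff.
(* [g2] has no E31 coordinate, so the second correction keeps the first layer clear, and [f2] takes
   values in the sub-bimodule [sub_rs] in degree k + 2. *)
have f2E x s : size s = k.+1 -> f2 (x :: s) = of_rs (quo_rs (f2 (x :: s))).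
  move=> sk; have p0 : quo_p (f2 (x :: s)) = 0.
    rewrite /f2 quo_pB pf1 // quo_p_cdiff.
    by rewrite cdiff0 subrr.
  have q0 : quo_q (f2 (x :: s)) = 0.
    rewrite /f2 quo_qB qE // quo_q_cdiff //.
    by rewrite subrr.
  by rewrite of_rsK.
have [||||g mg gE] := @vanishing_left1 (sub_rs R) k.+1 (fun s => quo_rs (f2 s)).
- by [].
- by [].
- by move=> s r x y t; rewrite mf2.
- move=> x y s sk; have /(congr1 quo_rs) := of_rs_cdiff (fun t => quo_rs (f2 t)) (x :: y :: s).
  rewrite -(@eq_cdiff _ _ _ f2); last first.
    by case=> // z t [st]; apply: f2E; rewrite st.
  by rewrite cf2 // => E; rewrite -[RHS]E; apply: injective_projections.
pose g3 s := of_rs (g s).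
exists (fun s => g1 s + (g2 s + g3 s)).
  do !apply: multilinearD => //.
  move=> s r x y t; rewrite /g3 mg.
  by do !apply: injective_projections; rewrite /= ?scale_regularE; ring.
move=> x s sk; rewrite !cdiffD -of_rs_cdiff -gE // -f2E //.
by rewrite /f2 /f1 [_ + (_ - _)]addrC subrK addrC subrK.
Qed.
End Vanishing.

(** * Comparison with matrix cochains *)

Section Matrices.
Variable R : comPzRingType.
Local Notation A := (s11 R).
Implicit Types (x y : A) (m n : mx3 R).

(** Indices in the form produced by [big_ord_recl], so that expanded matrix products fold back to
    them. *)
Definition i0 : 'I_3 := ord0.
Definition i1 : 'I_3 := lift ord0 ord0.
Definition i2 : 'I_3 := lift ord0 (lift ord0 ord0).

Lemma ord3_ind (P : 'I_3 -> Prop) : P i0 -> P i1 -> P i2 -> forall i, P i.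
Proof.
move=> P0 P1 P2 [[|[|[|//]]] lti3].
- by rewrite (_ : Ordinal _ = i0) //; apply: val_inj.
- by rewrite (_ : Ordinal _ = i1) //; apply: val_inj.
- by rewrite (_ : Ordinal _ = i2) //; apply: val_inj.
Qed.

Definition to_mx x : mx3 R := mx_S11 (ca x) (cb x) (cc x) (cd x) (ce x).
Definition of_mx m : A := (m i0 i0, m i0 i1, m i0 i2, m i1 i2, m i1 i1).

Definition quo_mx m : quo R := (m i2 i0, m i1 i0, m i2 i1, m i2 i2 - m i0 i0).
Definition mx_quo (u : quo R) : mx3 R :=
  \matrix_(i < 3, j < 3) match nat_of_ord i, nat_of_ord j with
    | 2, 0 => u.1.1.1 | 1, 0 => u.1.1.2 | 2, 1 => u.1.2 | 2, 2 => u.2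
    | _, _ => 0 end.

Lemma to_mxK : cancel to_mx of_mx.
Proof. by move=> [[[[a b] c] d] e]; rewrite /of_mx !mxE. Qed.

Lemma S11_to_mx x : S11 (to_mx x).
Proof. by do 5!eexists. Qed.

Lemma of_mxK m : S11 m -> to_mx (of_mx m) = m.
Proof.
by case=> a [b] [c] [d] [e] ->; rewrite -[mx_S11 _ _ _ _ _]/(to_mx (a, b, c, d, e)) to_mxK.
Qed.

Lemma mx_quoK : cancel mx_quo quo_mx.
Proof. by move=> [[[p q] r] s]; rewrite /quo_mx !mxE /= subr0. Qed.

Lemma of_mx_linear r m n : of_mx (r *: m + n) = r *: of_mx m + of_mx n.
Proof. by rewrite /of_mx !mxE. Qed.

Lemma to_mx_linear r x y : to_mx (r *: x + y) = r *: to_mx x + to_mx y.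
Proof.
rewrite /to_mx !s11E; apply/matrixP; elim/ord3_ind; elim/ord3_ind; rewrite !mxE /=; ring.
Qed.

Lemma quo_mx_linear r m n : quo_mx (r *: m + n) = r *: quo_mx m + quo_mx n.
Proof.
rewrite /quo_mx !mxE.
do !apply: injective_projections; rewrite /= ?scale_regularE; ring.
Qed.

Lemma to_mxM x y : to_mx (amul x y) = to_mx x *m to_mx y.
Proof.
apply/matrixP; rewrite /to_mx !s11E.
elim/ord3_ind; elim/ord3_ind; rewrite !mxE !big_ord_recl big_ord0 !mxE /=; ring.
Qed.

(** Together with [quo_mxMr], this identifies the formulas in [quo] with the actions by matrix
    multiplication. *)
Lemma quo_mxMl x m : quo_mx (to_mx x *m m) = lact x (quo_mx m).
Proof.
do !apply: injective_projections;
 rewrite /= !mxE !big_ord_recl !big_ord0 !mxE /= -/i0 -/i1 -/i2; ring.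
Qed.

Lemma quo_mxMr x m : quo_mx (m *m to_mx x) = ract (quo_mx m) x.
Proof.
do !apply: injective_projections;
 rewrite /= !mxE !big_ord_recl !big_ord0 !mxE /= -/i0 -/i1 -/i2; ring.
Qed.

Lemma S11_quo_mx m : S11 m <-> quo_mx m = 0.
Proof.
split.
  case=> a [b] [c] [d] [e] ->; rewrite /quo_mx !mxE /=.
  by rewrite subrr.
rewrite /quo_mx => -[p q r s]; suff <- : to_mx (of_mx m) = m by apply: S11_to_mx.
apply/matrixP.
by elim/ord3_ind; elim/ord3_ind; rewrite !mxE //= ?p ?q ?r //; apply/esym/subr0_eq.
Qed.
End Matrices.

(** * Cochains on tuples of matrices and cochains on lists *)

Section Comparison.
Variable R : comPzRingType.
Local Notation A := (s11 R).
Local Notation "x ** y" := (amul x y) (at level 40, left associativity).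
Implicit Types (x y : A) (s t : seq A) (m : mx3 R).

Fixpoint merge_at (i : nat) s : seq A :=
  match s, i with
  | x :: ((y :: t) as s'), 0 => x ** y :: t
  | x :: s', i'.+1 => x :: merge_at i' s'
  | _, _ => s
  end.

Lemma size_merge_at i s : (i.+1 < size s)%N -> size (merge_at i s) = (size s).-1.
Proof. by elim: i s => [|i IH] [|x [|y s]] //= lt; rewrite IH. Qed.

Lemma nth_merge_at i s j : (i.+1 < size s)%N ->
  nth 0 (merge_at i s) j = if (j < i)%N then nth 0 s j
    else if j == i then nth 0 s j ** nth 0 s j.+1 else nth 0 s j.+1.
Proof.
elim: i s j => [|i IH] [|x [|y s]] // [|j] //=; rewrite ltnS => lt.
by rewrite IH // ltnS eqSS.
Qed.

(** The recursion unfolded into the alternating sum used by [hdiff], up to a global sign. *)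
Lemma cract_sum (W : bimodule A) (f : seq A -> W) x s :
  cract f x s = \sum_(i < size s) (-1) ^+ i *: f (merge_at i (x :: s))
    + (-1) ^+ size s *: ract (f (belast x s)) (last x s).
Proof.
elim: s f x => [|y s IH] f x; first by rewrite big_ord0 add0r expr0 scale1r.
rewrite cract_cons IH [size _]/= big_ord_recl expr0 scale1r -addrA; congr (_ + _).
rewrite opprD exprS mulN1r scaleNr; congr (_ + _).
by rewrite -sumrN; apply: eq_bigr => i _; rewrite lift0 exprS mulN1r scaleNr.
Qed.

Definition to_tup n s : 'I_n -> mx3 R := fun i => to_mx (nth 0 s i).
Arguments to_tup : clear implicits.

Definition of_tup n (a : 'I_n -> mx3 R) : seq A := [seq of_mx (a i) | i <- enum 'I_n].

Lemma size_of_tup n (a : 'I_n -> mx3 R) : size (of_tup a) = n.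
Proof. by rewrite size_map size_enum_ord. Qed.

Lemma nth_of_tup n (a : 'I_n -> mx3 R) (i : 'I_n) : nth 0 (of_tup a) i = of_mx (a i).
Proof. by rewrite (nth_map i) ?size_enum_ord // nth_ord_enum. Qed.

Lemma tupS_to_tup n s : tupS (to_tup n s).
Proof. by move=> i; apply: S11_to_mx. Qed.

Lemma of_tupK n (a : 'I_n -> mx3 R) : tupS a -> to_tup n (of_tup a) = a.
Proof.
by move=> Sa; apply: functional_extensionality => i; rewrite /to_tup nth_of_tup of_mxK.
Qed.

Lemma to_tupK n s : size s = n -> of_tup (to_tup n s) = s.
Proof.
move=> sn; apply: (@eq_from_nth _ 0); rewrite size_of_tup // => i lti.
by rewrite (nth_of_tup _ (Ordinal lti)) to_mxK.
Qed.

Lemma to_mx0 : to_mx (0 : A) = 0.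
Proof.
have := to_mx_linear (-1) (0 : A) 0.
by rewrite scaler0 addr0 scaleN1r addNr.
Qed.

Lemma ext_to_tup n s k : size s = n.+1 -> ext (to_tup n.+1 s) k = to_mx (nth 0 s k).
Proof.
move=> sn; rewrite /ext; case: ltnP => ltk; first by rewrite /to_tup inordK.
by rewrite nth_default ?sn // to_mx0.
Qed.

Lemma ttail_to_tup n x s : size s = n -> ttail (to_tup n.+1 (x :: s)) = to_tup n s.
Proof.
move=> sn; apply: functional_extensionality => j.
by rewrite /ttail ext_to_tup //= sn.
Qed.

Lemma tinit_to_tup n x s : size s = n ->
  tinit (to_tup n.+1 (x :: s)) = to_tup n (belast x s).
Proof.
move=> sn; apply: functional_extensionality => j.
rewrite /tinit ext_to_tup /= ?sn // lastI /to_tup nth_rcons size_belast sn.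
by rewrite ltn_ord.
Qed.

Lemma tmerge_to_tup n (i : 'I_n) s : size s = n.+1 ->
  tmerge i (to_tup n.+1 s) = to_tup n (merge_at i s).
Proof.
move=> sn; apply: functional_extensionality => j.
rewrite /tmerge !ext_to_tup // /to_tup nth_merge_at ?sn ?ltnS //.
by case: ltnP => // _; case: eqP => // ->; rewrite to_mxM.
Qed.

Lemma quo_mxD m m' : quo_mx (m + m') = quo_mx m + quo_mx m'.
Proof. by rewrite -[m]scale1r quo_mx_linear !scale1r. Qed.

Lemma quo_mx0 : quo_mx (0 : mx3 R) = 0.
Proof. by apply/S11_quo_mx; rewrite -to_mx0; apply: S11_to_mx. Qed.

Lemma quo_mxZ r m : quo_mx (r *: m) = r *: quo_mx m.
Proof. by rewrite -[r *: m]addr0 quo_mx_linear quo_mx0 addr0. Qed.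

Lemma quo_mxB m m' : quo_mx (m - m') = quo_mx m - quo_mx m'.
Proof. by rewrite -[- m']scaleN1r quo_mxD quo_mxZ scaleN1r. Qed.

(* [f] and [F] are the same cochain with values in M_3(R)/S_11(R). *)
Definition represents n (f : cochain_fun R n) (F : seq A -> quo R) : Prop :=
  forall s, size s = n -> quo_mx (f (to_tup n s)) = F s.

Lemma quo_mx_hdiff n (f : cochain_fun R n) F s : represents f F ->
  size s = n.+1 -> quo_mx (hdiff f (to_tup n.+1 s)) = cdiff F s.
Proof.
move=> fF; case: s => // x s [sn].
have ext0 : ext (to_tup n.+1 (x :: s)) 0 = to_mx x by rewrite ext_to_tup //= sn.
have extn : ext (to_tup n.+1 (x :: s)) n = to_mx (last x s).
  by rewrite ext_to_tup ?(last_nth 0) /= sn.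
rewrite cdiff_cons cract_sum opprD addrA /hdiff !quo_mxD ext0 extn.
rewrite quo_mxMl quo_mxZ quo_mxMr ttail_to_tup // tinit_to_tup //.
rewrite !fF ?size_belast // sn exprS mulN1r scaleNr; congr (_ + _ - _).
rewrite (big_morph _ quo_mxD quo_mx0) -sumrN; apply: eq_bigr => i _.
rewrite quo_mxZ tmerge_to_tup /= ?sn // fF ?size_merge_at /= ?sn ?ltnS //.
by rewrite exprS mulN1r scaleNr.
Qed.

(** The placeholder y is free, so the entries to be compared in one slot become updates of the same
    tuple. *)
Lemma tset_to_tup n s t x y (lts : (size s < n)%N) :
  to_tup n (s ++ x :: t) = tset (to_tup n (s ++ y :: t)) (Ordinal lts) (to_mx x).
Proof.
apply: functional_extensionality => j; rewrite /tset /to_tup -val_eqE /= !nth_cat.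
case: (ltngtP j (size s)) => // [|->]; last by rewrite subnn.
by rewrite -subn_gt0; case: (_ - _)%N.
Qed.

Lemma cochain_multilinear n (f : cochain_fun R n) : cochain f ->
  exists2 F, multilinear F & represents f F.
Proof.
(* Extension by zero to the other lengths, since [multilinear] speaks of lists of every length. *)
move=> cf; exists (fun s => if size s == n then quo_mx (f (to_tup n s)) else 0); last first.
  by move=> s ->; rewrite eqxx.
move=> s r x y t; rewrite !size_cat /=.
case: eqP => [sn|_]; last by rewrite scaler0 addr0.
have lts : (size s < n)%N by rewrite -sn -[ltnLHS]addn0 ltn_add2l.
rewrite (tset_to_tup t (r *: x + y) 0 lts) (tset_to_tup t x 0 lts).
rewrite (tset_to_tup t y 0 lts) to_mx_linear.
have := cf _ (Ordinal lts) _ _ r (tupS_to_tup (s ++ 0 :: t)) (S11_to_mx x) (S11_to_mx y).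
move/S11_quo_mx; rewrite quo_mxB quo_mx_linear => /eqP.
by rewrite subr_eq0 => /eqP.
Qed.

Definition of_list_cochain n (F : seq A -> quo R) : cochain_fun R n :=
  fun a => mx_quo (F (of_tup a)).

Lemma represents_of_list_cochain n F : represents (@of_list_cochain n F) F.
Proof. by move=> s sn; rewrite /of_list_cochain mx_quoK to_tupK. Qed.

Lemma cochain_of_list_cochain n F : multilinear F -> cochain (@of_list_cochain n F).
Proof.
move=> mF a i x y r _ _ _; apply/S11_quo_mx.
have tsetE v : of_tup (tset a i v) =
    take i (of_tup a) ++ of_mx v :: drop i.+1 (of_tup a).
  apply: (@eq_from_nth _ 0) => [|j].
    rewrite size_cat /= size_takel ?size_drop !size_of_tup //; last exact: ltnW.
    by rewrite addnS -addSn subnKC.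
  rewrite size_of_tup => ltj; rewrite (nth_of_tup _ (Ordinal ltj)) /tset -val_eqE /=.
  rewrite nth_cat size_takel ?size_of_tup; last exact: ltnW.
  case: (ltngtP j i) => [lt|lt|->]; last by rewrite subnn.
    by rewrite nth_take // (nth_of_tup _ (Ordinal ltj)).
  by rewrite -subnSK //= nth_drop subnKC // (nth_of_tup _ (Ordinal ltj)).
rewrite quo_mxB quo_mx_linear /of_list_cochain !mx_quoK !tsetE of_mx_linear mF.
by rewrite subrr.
Qed.

Lemma cocycle_cdiff n (f : cochain_fun R n) F : represents f F ->
  cocycle f <-> cochain f /\ forall s, size s = n.+1 -> cdiff F s = 0.
Proof.
move=> fF; split=> -[cf df]; split=> //.
  by move=> s sn; rewrite -(quo_mx_hdiff fF sn); apply/S11_quo_mx/df/tupS_to_tup.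
move=> a Sa; apply/S11_quo_mx.
by rewrite -(of_tupK Sa) (quo_mx_hdiff fF) ?size_of_tup // df ?size_of_tup.
Qed.

Lemma coboundary_cdiff n (f : cochain_fun R n.+1) F G :
  represents f F -> cochain (@of_list_cochain n G) ->
  (forall s, size s = n.+1 -> F s = cdiff G s) -> coboundary f.
Proof.
move=> fF cG FG; exists (@of_list_cochain n G); split=> //.
move=> a Sa; apply/S11_quo_mx; rewrite -(of_tupK Sa) quo_mxB.
rewrite (quo_mx_hdiff (@represents_of_list_cochain n G)) ?size_of_tup //.
by rewrite fF ?size_of_tup // FG ?size_of_tup // subrr.
Qed.

Lemma H_zero_ge2 n : H_zero R n.+2.
Proof.
move=> f cf; have [F mF fF] := cochain_multilinear cf.1.
have [|G mG FG] := @vanishing_quo R n F mF.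
  by move=> x y s sn; apply: ((cocycle_cdiff fF).1 cf).2; rewrite /= sn.
apply: (coboundary_cdiff fF (cochain_of_list_cochain mG)).
by case=> [//|x s] [sn]; apply: FG.
Qed.

End Comparison.

(** * Degrees zero and one *)

Section LowDegrees.
Variable R : comPzRingType.
Local Notation A := (s11 R).
Local Notation "x ** y" := (amul x y) (at level 40, left associativity).
Implicit Types (x y : A).

Lemma cochain0 (f : cochain_fun R 0) : cochain f.
Proof. by move=> a []. Qed.

Lemma represents0 (f : cochain_fun R 0) :
  represents f (fun _ => quo_mx (f (@to_tup R 0 [::]))).
Proof. by case. Qed.

Lemma tup0 (a : 'I_0 -> mx3 R) : a = @to_tup R 0 [::].
Proof. by apply: functional_extensionality => -[]. Qed.

Lemma H0_iso : H_iso_R R 0.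
Proof.
exists (fun f => (quo_mx (f (@to_tup R 0 [::]))).2); split.
- by move=> f g r _ _; rewrite quo_mx_linear.
- move=> r; pose m : quo R := (0, 0, 0, r).
  exists (fun _ => mx_quo m); split; last by rewrite mx_quoK.
  apply/(cocycle_cdiff (represents0 (fun _ => mx_quo m))); split; first exact: cochain0.
  case=> [//|x [|//]] _; rewrite mx_quoK.
  by do !apply: injective_projections; rewrite /=; ring.
- move=> f /(cocycle_cdiff (represents0 f)) [_ df].
  set m := quo_mx _ in df *.
  have comm x : lact x m = ract m x by apply/subr0_eq/(df [:: x]).
  (* Commuting with e2 kills the E21 and E32 coordinates, commuting with beta the E31 coordinate. *)
  have q0 : m.1.1.2 = 0.
    have := congr1 (fun u : quo R => u.1.1.2) (comm (e2 R)).
    by rewrite /= mul1r mul0r addr0 mulr0.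
  have r0 : m.1.2 = 0.
    have := congr1 (fun u : quo R => u.1.2) (comm (e2 R)).
    by rewrite /= mul0r mulr0 add0r mulr1.
  have p0 : m.1.1.1 = 0.
    have := congr1 (fun u : quo R => u.1.1.2) (comm (beta R)).
    by rewrite /= mul1r mul0r add0r mulr0.
  split=> [s0 a _|cf].
    rewrite subr0 (tup0 a); apply/S11_quo_mx.
    by do !apply: injective_projections.
  have /S11_quo_mx := cf _ (@tupS_to_tup R 0 [::]).
  by rewrite subr0 -/m => ->.
Qed.

Lemma H1_iso : H_iso_R R 1.
Proof.
(* The inner derivation x m - m x has entries - m31 at (alpha, E32) and m31 at (beta, E21), so this
   sum vanishes on it. *)
exists (fun f => (quo_mx (f (@to_tup R 1 [:: alpha R]))).1.2
               + (quo_mx (f (@to_tup R 1 [:: beta R]))).1.1.2); split.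
- by move=> f g r _ _; rewrite !quo_mx_linear /= !scale_regularE; ring.
- move=> r.
  (* The derivation sending x to r E32 alpha_div(x). *)
  pose F (s : seq A) : quo R := if s is [:: x] then (0, 0, cb x * r, cc x * r) else 0.
  have fF := @represents_of_list_cochain R 1 F.
  exists (@of_list_cochain R 1 F); split; last by rewrite !fF //= mul1r addr0.
  apply/(cocycle_cdiff fF); split.
    apply: cochain_of_list_cochain => -[|z [|z' s]] r' x y [|w t] /=;
      rewrite ?scaler0 ?addr0 // !s11E.
    by do !apply: injective_projections; rewrite /= ?scale_regularE; ring.
  case=> [|x [|y [|]]] //= _; rewrite !s11E.
  by do !apply: injective_projections; rewrite /= ?scale_regularE; ring.
move=> f cf; have [F mF fF] := cochain_multilinear cf.1.
rewrite !fF //; split; last first.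
  case=> g [_ gf].
  have fE x : F [:: x] = cdiff (fun _ => quo_mx (g (@to_tup R 0 [::]))) [:: x].
    rewrite -fF // -(quo_mx_hdiff (represents0 g)) //; apply/esym/subr0_eq.
    by rewrite -quo_mxB; apply/S11_quo_mx/gf/tupS_to_tup.
  rewrite !fE /= /ca /cb /cd /=; ring.
move=> phi0; pose D x := F [:: x].
have DM x y : D (x ** y) = lact x (D y) + ract (D x) y.
  have := ((cocycle_cdiff fF).1 cf).2 [:: x; y] erefl.
  rewrite !cdiff_cons cract_cons => /eqP.
  by rewrite /D opprB addrA subr_eq0 => /eqP <-.
(* The E31 coordinate is an inner derivation into [simple11], hence 0 because R is commutative. *)
have p0 x : (D x).1.1.1 = 0.
  have [||||g mg gE] := @vanishing_left1 R (simple11 R) 0 (fun s => quo_p (F s)).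
  - by [].
  - by move=> _ m y; rewrite /= mulr0.
  - by move=> s r y z t; rewrite mF quo_pP.
  - move=> y z [|//] _; rewrite -quo_p_cdiff.
    by rewrite ((cocycle_cdiff fF).1 cf).2.
  by rewrite -[LHS]/(quo_p (D x)) gE //= mulrC subrr.
(* Leibniz at e2 x = e_x e2 + d_x beta. *)
have qE x : (D x).1.1.2 = ce x * (D (e2 R)).1.1.2 + cd x * (D (beta R)).1.1.2
    - (D (e2 R)).1.1.2 * ca x.
  have := congr1 (fun u : quo R => u.1.1.2) (DM (e2 R) x).
  rewrite e2_mul /D multilinear_cons // multilinear_consZ // /= -!/(D _) !scale_regularE => E.
  by rewrite E p0; ring.
have DE x : lact (e1 R) (D x) + ract (D (e1 R)) x
    = ca x *: D (e1 R) + (lact (alpha R) (D (alpha_div x)) + ract (D (alpha R)) (alpha_div x)).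
  by rewrite -!DM e1_mul /D multilinear_cons.
(* The first three coordinates are forced by evaluating x m - m x at beta, e2 and e1; the class of
   E33 commutes with A, so the last one can be 0. *)
pose m : quo R := ((D (beta R)).1.1.2, (D (e2 R)).1.1.2, (D (e1 R)).1.2, 0).
apply: (@coboundary_cdiff R 0 f F (fun _ => m) fF); first exact: cochain0.
(* The only place where the vanishing of the invariant enters. *)
have rA : (D (alpha R)).1.2 = - (D (beta R)).1.1.2.
  by apply/eqP; rewrite -addr_eq0; apply/eqP.
case=> [|x [|]] //= _; rewrite -/(D x).
have := congr1 (fun u : quo R => u.1.2) (DE x).
have := congr1 (fun u : quo R => u.2) (DE x).
rewrite /= !p0 (qE x) (qE (alpha_div x)) rA !alpha_divE !e1E !alphaE.
rewrite !scale_regularE !mul1r !mul0r !subr0 => /(canRL (addrK _)) Es /(canRL (addrK _)) Er.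
do !apply: injective_projections; rewrite /= ?p0 ?(qE x); [ring | ring | |].
  by rewrite Er; ring.
by rewrite Es; ring.
Qed.

End LowDegrees.

Local Close Scope ring_scope.

Theorem theorem5p11 (R : comPzRingType) (n : nat) :
  (n <= 1 -> H_iso_R R n) /\ (2 <= n -> H_zero R n).
Proof.
by case: n => [|[|n]]; split=> // _; [exact: H0_iso|exact: H1_iso|exact: H_zero_ge2].
Qed.
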